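(* Let $p$ be any odd prime, and let $$d_p=\sum_{j,k=1}^{(p-1)/2}\left(\frac{j^2+jk}{p}\right).$$ Then $$d_p\equiv-\frac{p-1}{2}\pmod 4.$$
   Context: In the definition of $d_p$, $\left(\frac{\cdot}{p}\right)$ denotes the Legendre symbol modulo $p$ (with value $0$ at multiples of $p$); $\frac{p-1}{2}$ is the ordinary integer. *)

(* Defs.v *)
From mathcomp Require Import all_boot all_order all_algebra.

Set Implicit Arguments.
Unset Strict Implicit.
Unset Printing Implicit Defensive.

Import GRing.Theory.
Local Open Scope ring_scope.

(* The Legendre symbol (a / p); meaningful for p an odd prime. Testing only
   the residues x in {0, ..., p - 1} loses nothing, as x ^ 2 mod p depends
   only on x mod p. *)
Definition legendre (a : int) (p : nat) : int :=
  if (p%:Z %| a)%Z then 0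
  else if [exists x : 'I_p, ((x%:Z) ^+ 2 == a %[mod p%:Z])%Z] then 1
  else -1.

(* For odd p, (p.-1)./2 is the exact integer (p - 1) / 2. *)
Definition legendre_dsum (p : nat) : int :=
  \sum_(1 <= j < ((p.-1)./2).+1) \sum_(1 <= k < ((p.-1)./2).+1)
    legendre (j%:Z ^+ 2 + j%:Z * k%:Z) p.

(* Main.v *)
Require Import Defs.
From mathcomp Require Import all_boot all_order all_algebra.
From mathcomp Require Import finfield ring zify.

(** Write p = 2n + 1 and T = 1 + ... + n = n(n+1)/2. No j(j+k) with
    1 <= j, k <= n is divisible by p, so the sum consists of n^2 signs. Modulo 4
    a sum of N signs depends only on N and on the product of the signs: it is
    N - 1 + (product) (lemma [sum_signs_mod4]). So everything reduces to showing
    that the product of the Legendre symbols is (-1)^T: the sum is then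
    n^2 - 1 + (-1)^T, and adding n gives 2T - 1 + (-1)^T, a multiple of 4
    whatever the parity of T.

    By Euler's criterion ([legendre_euler]) the product of the symbols is, in
    F_p, the n-th power of the product of all the j(j+k). The factors j
    contribute n!^n. In the product of the j+k, the off-diagonal factors pair up
    by symmetry into a square s^2, and the diagonal contributes 2^n n!. Hence
    the n-th power is
      (n!^n 2^n n! s^2)^n = (n!^2)^T (2^n)^n s^(2n).
    Here s^(2n) = 1 by Fermat, n!^2 = (-1)^(n+1) by Wilson
    ([Fp_half_fact_sqr]), and 2^n = (-1)^T, the second supplement to quadratic
    reciprocity ([Fp_gauss_two]). The exponent of -1 is
    (n+1)T + nT = (2n+1)T, which has the parity of T. *)

Set Implicit Arguments.
Unset Strict Implicit.

Import GRing.Theory.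

Local Open Scope ring_scope.

(** * Squares in F_p and Euler's criterion *)

Lemma Fp_nat_neq0 (p m : nat) :
  prime p -> (0 < m < p)%N -> (m%:R : 'F_p) != 0.
Proof.
move=> p_pr /andP[m_gt0 m_lt].
by rewrite -(dvdn_pcharf (pchar_Fp p_pr)) gtnNdvd.
Qed.

Lemma Fp_fermat (n p : nat) (x : 'F_p) :
  prime p -> p = n.*2.+1 -> x != 0 -> x ^+ n.*2 = 1.
Proof.
move=> p_pr pE x_neq0; apply: (mulfI x_neq0).
by rewrite -exprS -pE mulr1; have := expf_card x; rewrite card_Fp.
Qed.

(** A square y^2 satisfies y^(2n) = 1 by Fermat. Conversely, 1^2, ..., n^2 are n
    distinct roots of X^n - 1, which leaves no room for a root that is not a
    square. *)
Lemma Fp_euler (n p : nat) (x : 'F_p) :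
    prime p -> p = n.*2.+1 -> x != 0 ->
  [exists y : 'F_p, y ^+ 2 == x] = (x ^+ n == 1).
Proof.
move=> p_pr pE x_neq0.
have n_gt0 : (0 < n)%N by move: (prime_gt1 p_pr); lia.
apply/idP/idP => [/existsP[y /eqP yx]|xn].
  have y_neq0 : y != 0 by apply: contraNneq x_neq0 => y0; rewrite -yx y0 expr0n.
  by rewrite -yx -exprM mul2n (Fp_fermat p_pr).
(* If x is not a square, X^n - 1 gets n + 1 distinct roots. *)
apply: contraLR (leqnn n) => /existsPn nsq; rewrite -ltnNge.
pose sqs := [seq (i%:R ^+ 2 : 'F_p) | i <- iota 1 n].
have uniq_sqs : uniq (x :: sqs).
  rewrite /= map_inj_in_uniq ?iota_uniq ?andbT => [|i j].
    by apply/mapP=> -[i _ xi]; move: (nsq i%:R); rewrite xi eqxx.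
  rewrite !mem_iota => i_le j_le /eqP; rewrite eqf_sqr => /orP[/eqP|].
    move/(congr1 (@nat_of_ord _)); rewrite !val_Fp_nat // !modn_small; lia.
  rewrite -addr_eq0 -natrD; apply: contraTeq => _; apply: Fp_nat_neq0 => //; lia.
have /max_poly_roots : ('X^n - 1 : {poly 'F_p}) != 0.
  by rewrite -size_poly_eq0 size_XnsubC.
move=> /(_ (x :: sqs)); rewrite size_XnsubC // /= size_map size_iota.
apply=> //; rewrite /root !hornerE subr_eq0 xn /=.
apply/allP=> _ /mapP[i i_in ->].
rewrite /root !hornerE subr_eq0 -exprM mul2n.
rewrite (Fp_fermat p_pr) // Fp_nat_neq0 //; move: i_in; rewrite mem_iota; lia.
Qed.

Lemma legendre_sign (a : int) (p : nat) :
  ~~ (p%:Z %| a)%Z -> legendre a p = 1 \/ legendre a p = -1.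
Proof. by rewrite /legendre => /negPf->; case: ifP => _; [left|right]. Qed.

Lemma legendre_euler (n p : nat) (a : int) :
    prime p -> p = n.*2.+1 -> ~~ (p%:Z %| a)%Z ->
  (legendre a p)%:~R = (a%:~R : 'F_p) ^+ n.
Proof.
move=> p_pr pE pNa; rewrite /legendre (negPf pNa).
have a_neq0 : (a%:~R : 'F_p) != 0 by rewrite -(dvdz_pcharf (pchar_Fp p_pr)).
have -> : [exists x : 'I_p, ((x%:Z) ^+ 2 == a %[mod p%:Z])%Z]
          = [exists y : 'F_p, y ^+ 2 == a%:~R].
  have modE (m : nat) :
      ((m%:Z) ^+ 2 == a %[mod p%:Z])%Z = ((m%:R : 'F_p) ^+ 2 == a%:~R).
    by rewrite eqz_mod_dvd (dvdz_pcharf (pchar_Fp p_pr)) rmorphB rmorphXn subr_eq0.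
  apply/existsP/existsP=> [[x]|[y]].
    by rewrite modE; exists x%:R.
  have y_lt : (y < p)%N by rewrite -[X in (_ < X)%N](card_Fp p_pr) card_ord.
  by exists (Ordinal y_lt); rewrite modE /= natr_Zp.
rewrite (Fp_euler p_pr pE a_neq0); case: eqP => [->|/eqP an] //.
(* For a nonsquare, a^n is a square root of a^(2n) = 1 other than 1. *)
have := Fp_fermat p_pr pE a_neq0; rewrite -muln2 exprM => /eqP.
by rewrite sqrf_eq1 (negPf an) /= => /eqP->.
Qed.

(** * Sums of signs modulo 4 *)

Lemma prod_signs (T : eqType) (s : seq T) (e : T -> int) :
    {in s, forall x, e x = 1 \/ e x = -1} ->
  \prod_(x <- s) e x = 1 \/ \prod_(x <- s) e x = -1.
Proof.
move=> e_sign; rewrite big_seq.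
elim/big_ind: _ => [|x y [->|->] [->|->]|x /e_sign //]; rewrite ?mulr1 ?mul1r;
  by [left|right].
Qed.

(** For signs a and b, 4 divides (a - 1)(b - 1), that is, a + b = 1 + ab modulo
    4; the general case follows by adding one sign at a time. *)
Lemma sum_signs_mod4 (T : eqType) (s : seq T) (e : T -> int) :
    {in s, forall x, e x = 1 \/ e x = -1} ->
  exists m : int,
    \sum_(x <- s) e x = (size s)%:Z - 1 + \prod_(x <- s) e x + 4 * m.
Proof.
elim: s => [|x s IHs] e_sign; first by exists 0; rewrite !big_nil.
have s_sign : {in s, forall y, e y = 1 \/ e y = -1}.
  by move=> y ys; apply: e_sign; rewrite inE ys orbT.
have [m sumE] := IHs s_sign.
rewrite !big_cons sumE /= intS.
by case: (prod_signs s_sign) => ->; case: (e_sign x (mem_head _ _)) => ->;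
  [exists m|exists m|exists m|exists (m - 1)]; ring.
Qed.

(** * The product of the j(j+k) in F_p *)

(** Used with f j k = j + k: in the end only the diagonal matters, since a square
    disappears on raising to the power (p - 1)/2 modulo p. *)
Lemma prod_square_symmetric (R : comPzRingType) (f : nat -> nat -> R) (n : nat) :
    (forall j k, f j k = f k j) ->
  \prod_(1 <= j < n.+1) \prod_(1 <= k < n.+1) f j k
  = \prod_(1 <= j < n.+1) f j j
    * (\prod_(1 <= j < n.+1) \prod_(1 <= k < j) f j k) ^+ 2.
Proof.
move=> f_sym; elim: n => [|n IHn]; first by rewrite !big_nil expr1n mulr1.
rewrite ![\prod_(1 <= j < n.+2) _]big_nat_recr //=.
rewrite (eq_bigr (fun j => \prod_(1 <= k < n.+1) f j k * f n.+1 j)); last first.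
  by move=> j _; rewrite big_nat_recr //= f_sym.
rewrite big_split /= IHn.
ring.
Qed.

(** Wilson's theorem, with the factors n+1, ..., 2n of (2n)! rewritten as the
    opposites of n, ..., 1. *)
Lemma Fp_half_fact_sqr (n p : nat) :
  prime p -> p = n.*2.+1 -> ((n`!)%:R : 'F_p) ^+ 2 = (-1) ^+ n.+1.
Proof.
move=> p_pr pE.
have wilson : ((n.*2`!)%:R : 'F_p) = -1.
  apply/eqP; rewrite -addr_eq0 natr1 -(dvdn_pcharf (pchar_Fp p_pr)).
  by rewrite -[n.*2]/(n.*2.+1.-1) -pE -Wilson // prime_gt1.
have : ((n.*2`!)%:R : 'F_p) = (-1) ^+ n * (n`!)%:R ^+ 2.
  rewrite !fact_prod (big_cat_nat _ (n := n.+1)) //=; last by lia.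
  rewrite natrM expr2 mulrA mulrC; congr (_ * _).
  rewrite big_nat_rev /= -{1}[n.+1]add0n big_addn big_add1 /=.
  have -> : (n.*2.+1 - n.+1 = n)%N by lia.
  rewrite !natr_prod -[X in (-1) ^+ X]subn0 -prodr_const_nat -big_split /=.
  apply: eq_big_nat => i i_lt; apply/eqP.
  rewrite mulN1r -addr_eq0 -natrD -(dvdn_pcharf (pchar_Fp p_pr)); apply/eqP.
  have -> : (n.+1 + n.*2.+1 - (i + n.+1).+1 + i.+1 = p)%N by lia.
  by rewrite modnn.
rewrite wilson => /(congr1 ( *%R ((-1) ^+ n))).
by rewrite mulrA -expr2 sqrr_sign mul1r => <-; rewrite exprSr.
Qed.

(** Gauss's argument: modulo p, (-1)^j j is j for even j and the even number
    p - j for odd j. As j runs over 1, ..., n these residues are 2, 4, ..., 2n in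
    some order, so (-1)^T n! = 2^n n!. *)
Lemma Fp_gauss_two (n p : nat) :
    prime p -> p = n.*2.+1 ->
  (2%:R : 'F_p) ^+ n = (-1) ^+ (\sum_(1 <= j < n.+1) j)%N.
Proof.
move=> p_pr pE.
pose g (j : nat) := if odd j then (p - j)%N else j.
have g_evens : perm_eq [seq g j | j <- iota 1 n] [seq j.*2 | j <- iota 1 n].
  have uniq_g : uniq [seq g j | j <- iota 1 n].
    rewrite map_inj_in_uniq ?iota_uniq // => i j; rewrite !mem_iota /g.
    by case: ifP => io; case: ifP => jo; lia.
  have sub_g : {subset [seq g j | j <- iota 1 n] <= [seq j.*2 | j <- iota 1 n]}.
    move=> _ /mapP[j j_in ->]; apply/mapP; exists (g j)./2;
      move: j_in; rewrite !mem_iota /g; case: ifP => jo; lia.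
  have [|_ eq_g] := uniq_min_size uniq_g sub_g; first by rewrite !size_map.
  apply: uniq_perm => //.
  by rewrite map_inj_uniq ?iota_uniq // => i j; lia.
have fact_neq0 : ((n`!)%:R : 'F_p) != 0.
  rewrite fact_prod natr_prod prodf_seq_neq0; apply/allP=> j.
  rewrite mem_index_iota /= => j_le; apply: Fp_nat_neq0 => //; lia.
have iotaE : index_iota 1 n.+1 = iota 1 n by rewrite /index_iota subn1.
apply: (mulfI fact_neq0).
transitivity (\prod_(1 <= j < n.+1) (j.*2%:R : 'F_p)).
  have -> : (2%:R : 'F_p) ^+ n = \prod_(1 <= j < n.+1) 2%:R.
    by rewrite prodr_const_nat subn1.
  rewrite fact_prod natr_prod -big_split /=.
  by apply: eq_bigr => j _; rewrite -natrM muln2.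
rewrite iotaE -(big_map double xpredT (fun j => j%:R)).
rewrite -(perm_big _ g_evens) big_map fact_prod natr_prod iotaE.
rewrite -prodrXr -big_split /=; apply: eq_big_seq => j.
rewrite mem_iota /g -signr_odd => j_le; case: ifP => jo; rewrite ?mulr1 //.
by rewrite natrB ?pchar_Fp_0 ?sub0r ?expr1 ?mulrN1 //; lia.
Qed.

(** Signs can be compared in F_p, because 1 and -1 differ there for p > 2. *)
Lemma Fp_sign_inj (p t : nat) (x : int) :
    prime p -> (2 < p)%N -> x = 1 \/ x = -1 ->
  x%:~R = (-1 : 'F_p) ^+ t -> x = (-1) ^+ t.
Proof.
move=> p_pr p_gt2.
have one_neqN1 : (1 : 'F_p) != -1.
  by rewrite -addr_eq0 -[1 + 1]/(2%:R); apply: Fp_nat_neq0.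
rewrite -(signr_odd 'F_p) -(signr_odd int); case: (odd t); rewrite ?expr0 ?expr1.
  case=> [->|-> _]; last reflexivity.
  by move/eqP; rewrite (negPf one_neqN1).
case=> [-> _|->]; first reflexivity.
by move/eqP; rewrite rmorphN1 eq_sym (negPf one_neqN1).
Qed.

Lemma triangle_double (n : nat) :
  ((\sum_(1 <= j < n.+1) j).*2 = n * n.+1)%N.
Proof.
elim: n => [|n IHn]; first by rewrite big_nil.
by rewrite big_nat_recr //= doubleD IHn; lia.
Qed.

Lemma Fp_euler_prod_pairs (n p : nat) :
    prime p -> p = n.*2.+1 ->
  (\prod_(1 <= j < n.+1) \prod_(1 <= k < n.+1) (j * (j + k))%:R : 'F_p) ^+ n
  = (-1) ^+ (\sum_(1 <= j < n.+1) j)%N.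
Proof.
move=> p_pr pE.
pose h : 'F_p := (n`!)%:R.
have h_prod : h = \prod_(1 <= j < n.+1) j%:R by rewrite /h fact_prod natr_prod.
have constE (x : 'F_p) : \prod_(1 <= j < n.+1) x = x ^+ n.
  by rewrite prodr_const_nat subn1.
have diagE : \prod_(1 <= j < n.+1) ((j + j)%:R : 'F_p) = 2%:R ^+ n * h.
  rewrite h_prod -constE -big_split /=.
  by apply: eq_bigr => j _; rewrite -natrM mul2n addnn.
have -> : \prod_(1 <= j < n.+1) \prod_(1 <= k < n.+1) ((j * (j + k))%:R : 'F_p)
    = h ^+ n * \prod_(1 <= j < n.+1) \prod_(1 <= k < n.+1) (j + k)%:R.
  rewrite h_prod -prodrXl -big_split /=; apply: eq_bigr => j _.
  by rewrite -constE -big_split /=; apply: eq_bigr => k _; rewrite natrM.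
rewrite (prod_square_symmetric (f := fun j k => (j + k)%:R : 'F_p)) => [|j k]; last first.
  by rewrite addnC.
rewrite diagE.
set s := \prod_(1 <= j < n.+1) \prod_(1 <= k < j) _.
have s_neq0 : s != 0.
  rewrite prodf_seq_neq0; apply/allP=> j; rewrite mem_index_iota /= => j_in.
  rewrite prodf_seq_neq0; apply/allP=> k; rewrite mem_index_iota /= => k_in.
  apply: Fp_nat_neq0 => //; lia.
set T := (\sum_(1 <= j < n.+1) j)%N.
(* The exponent n(n+1) of h equals 2T, so only h^2 is needed. *)
have -> : (h ^+ n * (2%:R ^+ n * h * s ^+ 2)) ^+ n
    = (h ^+ 2) ^+ T * (2%:R ^+ n) ^+ n * s ^+ n.*2.
  rewrite -[(h ^+ 2) ^+ T]exprM mul2n triangle_double mulnS exprD.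
  by rewrite !exprM !exprMn -addnn (exprD s); ring.
rewrite (Fp_fermat p_pr pE s_neq0) mulr1.
rewrite (Fp_half_fact_sqr p_pr pE) (Fp_gauss_two p_pr pE) -/T.
have T_parity : odd (n.+1 * T + T * n) = odd T.
  by rewrite oddD !oddM /=; case: (odd n); case: (odd T).
by rewrite -!exprM -exprD -[LHS]signr_odd T_parity signr_odd.
Qed.

Theorem theorem1p3 (p : nat) (p_prime : prime p) (p_odd : odd p) :
  (legendre_dsum p = - ((p.-1)./2)%:Z %[mod 4])%Z.
Proof.
have pE : p = (p.-1)./2.*2.+1 by lia.
have p_gt2 : (2 < p)%N := odd_prime_gt2 p_odd p_prime.
rewrite /legendre_dsum; move: (p.-1./2) pE => n pE.
pose a (z : nat * nat) : int := z.1%:Z ^+ 2 + z.1%:Z * z.2%:Z.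
pose I := [seq (j, k) | j <- index_iota 1 n.+1, k <- index_iota 1 n.+1].
have a_unit : {in I, forall z, ~~ (p%:Z %| a z)%Z}.
  move=> _ /allpairsP[[j k] /= [j_in k_in ->]].
  move: j_in k_in; rewrite !mem_index_iota => j_in k_in.
  rewrite (dvdz_pcharf (pchar_Fp p_prime)) /a /= expr2 -mulrDr rmorphM.
  rewrite mulf_neq0 // -?PoszD Fp_nat_neq0 //; lia.
have a_sign : {in I, forall z, legendre (a z) p = 1 \/ legendre (a z) p = -1}.
  by move=> z /a_unit; apply: legendre_sign.
set T := (\sum_(1 <= j < n.+1) j)%N.
have T_double : (T.*2 = n * n.+1)%N := triangle_double n.
have prod_sign : \prod_(z <- I) legendre (a z) p = (-1) ^+ T.
  apply: (Fp_sign_inj p_prime p_gt2); first exact: prod_signs.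
  rewrite rmorph_prod -(Fp_euler_prod_pairs p_prime pE).
  rewrite (eq_big_seq (fun z => (a z)%:~R ^+ n)) => [|z /a_unit az]; last first.
    exact: legendre_euler.
  rewrite prodrXl big_allpairs; congr (_ ^+ n).
  apply: eq_bigr => j _; apply: eq_bigr => k _.
  by rewrite /a /= expr2 -mulrDr.
have sizeI : size I = (n * n)%N.
  by rewrite size_allpairs size_iota subn1.
have [m] := sum_signs_mod4 a_sign.
rewrite prod_sign sizeI big_allpairs /a /= => ->.
apply/eqP; rewrite eqz_mod_dvd -signr_odd; apply/dvdzP.
(* n^2 + n = 2T, and 2T - 1 + (-1)^T is 4 times the integer part of T/2. *)
exists (m + T./2).
case oT: (odd T); rewrite ?expr0 ?expr1; lia.
Qed.
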